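(* Let $\ell>2$ be prime and let $\mathbf{F}=(F_1,F_2)$ be a $2$-dimensional symmetric formal group law over $\mathbb{Z}_\ell$ of height $4$ whose exponent $r$ equals $2$. Then the wild inertia group $I_{\mathrm{wild}}\subset\mathrm{Gal}(\overline{\mathbb{Q}}_\ell/\mathbb{Q}_\ell)$ acts trivially on the $\mathbb{F}_\ell$-vector space of $\ell$-torsion points of $\mathbf{F}(\overline{\mathfrak{m}})$.
   Context: $v$ is the valuation on $\overline{\mathbb{Q}}_\ell$ with $v(\ell)=1$, $\overline{\mathfrak{m}}=\{x:v(x)>0\}$, and $\mathbf{F}(\overline{\mathfrak{m}})$ is $\overline{\mathfrak{m}}\times\overline{\mathfrak{m}}$ with the group law given by $\mathbf{F}$, with Galois action coordinatewise. The formal group law is symmetric if $F_2(X_2,X_1,Y_2,Y_1)=F_1(X_1,X_2,Y_1,Y_2)$. The multiplication-by-$\ell$ series $[\ell]=([\ell]_1,[\ell]_2)$ is defined by $[1](\mathbf{Z})=\mathbf{Z}$, $[m+1](\mathbf{Z})=\mathbf{F}(\mathbf{Z},[m](\mathbf{Z}))$. The height of $\mathbf{F}$ is $h$ with $\ell^h=\dim_{\mathbb{F}_\ell}\mathbb{F}_\ell[[Z_1,Z_2]]/\langle\overline{[\ell]}_1,\overline{[\ell]}_2\rangle$, where bars denote reduction mod $\ell$. The exponent $r$ of $\mathbf{F}$ is the largest integer $r$ such that both $\overline{[\ell]}_1,\overline{[\ell]}_2$ lie in $\mathbb{F}_\ell[[Z_1^{\ell^r},Z_2^{\ell^r}]]$.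 *)

(* Defs.v *)
From HB Require Import structures.
From mathcomp Require Import all_boot all_order all_algebra.
From mathcomp Require Import mpoly.
Set Implicit Arguments. Unset Strict Implicit. Unset Printing Implicit Defensive.
Import Order.TTheory GRing.Theory Num.Theory.
Local Open Scope ring_scope.

Definition pser (n : nat) (R : Type) := 'X_{1..n} -> R.

Section PSer.
Variable R : comNzRingType.

Definition ptrunc n (s : pser n R) (b : nat) : {mpoly R[n]} :=
  \sum_(m : 'X_{1..n < b}) s m *: 'X_[m].

Definition of_mpoly n (p : {mpoly R[n]}) : pser n R := fun m => p@_m.

Definition pvar n (i : 'I_n) : pser n R := of_mpoly 'X_i.
Definition pzero n : pser n R := fun _ => 0.

Definition pcomp n k (s : pser n R) (g : n.-tuple (pser k R)) : pser k R :=
  fun m => ((ptrunc s (mdeg m).+1)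
             \mPo [tuple ptrunc (tnth g i) (mdeg m).+1 | i < n]) @_ m.

Definition pmul n (a b : pser n R) : pser n R :=
  fun m => (ptrunc a (mdeg m).+1 * ptrunc b (mdeg m).+1) @_ m.
End PSer.

Section Valued.
Variable L : fieldType.
Variable v : L -> rat.

(* v is only meaningful on nonzero elements; v 0 = +oo by convention *)
Definition vge (x : L) (q : rat) : bool := (x == 0) || (q <= v x).
Definition vgt (x : L) (q : rat) : bool := (x == 0) || (q < v x).

Definition vconv (u : nat -> L) (y : L) : Prop :=
  forall q : rat, exists N : nat, forall n, (N <= n)%N -> vgt (u n - y) q.
Definition vcauchy (u : nat -> L) : Prop :=
  forall q : rat, exists N : nat, forall n m, (N <= n)%N -> (N <= m)%N ->
    vgt (u n - u m) q.

(* (L, v, K) is (an isomorphic copy of) (Qbar_l, v, Q_l) with v(l) = 1 *)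
Definition Qlbar_data (l : nat) (K : {pred L}) : Prop :=
  [/\
      [/\ (forall x y, x != 0 -> y != 0 -> v (x * y) = v x + v y),
          (forall x y q, vge x q -> vge y q -> vge (x + y) q) &
          (l%:R != 0 :> L) /\ v l%:R = 1],
      [/\ 1 \in K, {in K &, forall x y, x - y \in K},
          {in K &, forall x y, x * y \in K} &
          {in K, forall x, x != 0 -> x^-1 \in K}],
      (* K is discretely valued, with residue field F_l, and complete:
         together with v(l) = 1 this says K is isomorphic to Q_l *)
      [/\ {in K, forall x, x != 0 -> exists z : int, v x = z%:~R},
          {in K, forall x, vge x 0 -> exists k : nat, vgt (x - k%:R) 0} &
          (forall u : nat -> L, (forall n, u n \in K) -> vcauchy u ->
             exists2 y, y \in K & vconv u y)],
      (forall p : {poly L}, (1 < size p)%N -> exists x, root p x) &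
      (forall x : L, exists p : {poly L},
          [/\ p != 0, p \is a polyOver K & root p x])].

Definition in_Gal (K : {pred L}) (sigma : {rmorphism L -> L}) : Prop :=
  bijective sigma /\ {in K, forall x, sigma x = x}.

(* wild inertia: the first ramification group,
   v(sigma(x)/x - 1) > 0 for all x <> 0 *)
Definition in_wild_inertia (K : {pred L}) (sigma : {rmorphism L -> L}) : Prop :=
  in_Gal K sigma /\ forall x : L, x != 0 -> vgt (sigma x / x - 1) 0.

Definition pser_eval_to n (s : pser n L) (z : n.-tuple L) (y : L) : Prop :=
  vconv (fun N => (ptrunc s N).@[tnth z]) y.

End Valued.

Section FGL.
Variable R : comNzRingType.

Local Notation v4 i := (pvar R (@Ordinal 4 i isT)).
Local Notation v2 i := (pvar R (@Ordinal 2 i isT)).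
Local Notation v6 i := (pvar R (@Ordinal 6 i isT)).

(* F = (F1, F2), each a power series in X1, X2, Y1, Y2 (variables 0,1,2,3) *)
Definition is_fgl2 (F1 F2 : pser 4 R) : Prop :=
  let F i := if i == 0%N then F1 else F2 in
  [/\
      (forall i : 'I_2, pcomp (F i) [tuple v2 0; v2 1; @pzero R 2; @pzero R 2]
                          =1 pvar R i),
      (forall i : 'I_2, pcomp (F i) [tuple @pzero R 2; @pzero R 2; v2 0; v2 1]
                          =1 pvar R i),
      (forall i : 'I_2,
         pcomp (F i) [tuple pcomp F1 [tuple v6 0; v6 1; v6 2; v6 3];
                            pcomp F2 [tuple v6 0; v6 1; v6 2; v6 3];
                            v6 4; v6 5]
         =1 pcomp (F i) [tuple v6 0; v6 1;
                               pcomp F1 [tuple v6 2; v6 3; v6 4; v6 5];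
                               pcomp F2 [tuple v6 2; v6 3; v6 4; v6 5]]) &
      (forall i : 'I_2, pcomp (F i) [tuple v4 2; v4 3; v4 0; v4 1] =1 F i)].

Definition fgl_symmetric (F1 F2 : pser 4 R) : Prop :=
  pcomp F2 [tuple v4 1; v4 0; v4 3; v4 2] =1 F1.

(* fgl_mult_aux F1 F2 k = [k+1](Z), with [1](Z) = Z, [m+1](Z) = F(Z,[m](Z)) *)
Fixpoint fgl_mult_aux (F1 F2 : pser 4 R) (k : nat) : pser 2 R * pser 2 R :=
  match k with
  | 0 => (v2 0, v2 1)
  | k'.+1 => let p := fgl_mult_aux F1 F2 k' in
             (pcomp F1 [tuple v2 0; v2 1; p.1; p.2],
              pcomp F2 [tuple v2 0; v2 1; p.1; p.2])
  end.

(* [m](Z), for m >= 1 *)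
Definition fgl_mult (F1 F2 : pser 4 R) (m : nat) := fgl_mult_aux F1 F2 m.-1.

Definition in_ideal2 (f g h : pser 2 R) : Prop :=
  exists a b : pser 2 R, forall m, h m = pmul a f m + pmul b g m.

Definition quot_dim (f g : pser 2 R) (N : nat) : Prop :=
  exists e : 'I_N -> pser 2 R,
    (forall h : pser 2 R, exists c : 'I_N -> R,
        in_ideal2 f g (fun m => h m - \sum_(i < N) c i * e i m)) /\
    (forall c : 'I_N -> R,
        in_ideal2 f g (fun m => \sum_(i < N) c i * e i m) -> forall i, c i = 0).

Definition in_pow_sub (l r : nat) (f : pser 2 R) : Prop :=
  forall m : 'X_{1..2}, f m != 0 ->
    (l ^ r %| m (@Ordinal 2 0 isT))%N /\ (l ^ r %| m (@Ordinal 2 1 isT))%N.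
End FGL.

Definition reduces_to (L : fieldType) (v : L -> rat) (l : nat) (a : L) (c : 'F_l) : Prop :=
  vgt v (a - (nat_of_ord c)%:R) 0.

Definition reduces_ser (L : fieldType) (v : L -> rat) (l : nat)
    (s : pser 2 L) (sb : pser 2 'F_l) : Prop :=
  forall m, reduces_to v (s m) (sb m).

Definition fgl_height (L : fieldType) (v : L -> rat) (l : nat)
    (F1 F2 : pser 4 L) (h : nat) : Prop :=
  exists fb gb : pser 2 'F_l,
    [/\ reduces_ser v (fgl_mult F1 F2 l).1 fb,
        reduces_ser v (fgl_mult F1 F2 l).2 gb &
        quot_dim fb gb (l ^ h)].

Definition fgl_exponent (L : fieldType) (v : L -> rat) (l : nat)
    (F1 F2 : pser 4 L) (r : nat) : Prop :=
  exists fb gb : pser 2 'F_l,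
    [/\ reduces_ser v (fgl_mult F1 F2 l).1 fb,
        reduces_ser v (fgl_mult F1 F2 l).2 gb,
        in_pow_sub l r fb /\ in_pow_sub l r gb &
        forall r', in_pow_sub l r' fb -> in_pow_sub l r' gb -> (r' <= r)%N].

(* Main.v *)
(* Put q = l^2. Since the exponent is 2, modulo l both components of [l] are
   series in Z1^q and Z2^q; since the height is 4, the 2x2 matrix of their
   coefficients at Z1^q and Z2^q is invertible modulo l. Comparing l Z with
   these leading terms, a nonzero torsion point z has minimal valuation
   c >= 1/(q - 1). If sigma is wild and w = sigma z, then w is torsion as well
   and d = min v(z_i - w_i) > c. All terms of [l](z) - [l](w) other than
   l (z - w) then have valuation > 1 + d, because q d > 1 + d and l divides the
   middle binomial coefficients of (w + (z - w))^q; so d cannot be finite. *)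
From HB Require Import structures.
From mathcomp Require Import all_boot all_order all_algebra.
From mathcomp Require Import mpoly ring.
Require Import Defs.
Set Implicit Arguments. Unset Strict Implicit. Unset Printing Implicit Defensive.
Import Order.TTheory GRing.Theory Num.Theory.
Local Open Scope ring_scope.

(** * Truncations and the low-degree coefficients of composites *)

Lemma mcoeff_ptrunc (R : comNzRingType) n (s : pser n R) b (m : 'X_{1..n}) :
  (ptrunc s b)@_m = if (mdeg m < b)%N then s m else 0.
Proof.
rewrite /ptrunc raddf_sum /=; under eq_bigr do rewrite mcoeffZ mcoeffX.
case: ifPn => [lt_m | ge_m].
  rewrite (bigD1 (BMultinom lt_m)) //= eqxx mulr1 big1 ?addr0 // => k.
  by rewrite -val_eqE /= => /negPf->; rewrite mulr0.
rewrite big1 // => k _; case: eqP => [Ek|_]; rewrite ?mulr0 //.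
by move: ge_m; rewrite -Ek bmdeg.
Qed.

Lemma ptrunc2E (R : comNzRingType) n (s : pser n R) :
  ptrunc s 2 = (s 0%MM)%:MP + \sum_(i < n) s U_(i)%MM *: 'X_i.
Proof.
apply/mpolyP => m; rewrite mcoeff_ptrunc mcoeffD mcoeffC raddf_sum /=.
under eq_bigr do rewrite mcoeffZ mcoeffX.
have [->|m0] := eqVneq m 0%MM.
  rewrite mdeg0 /= mulr1 big1 ?addr0 // => i _.
  by rewrite mnm1_eq0 mulr0.
rewrite mulr0 add0r; case: ifPn => [lt2|ge2].
  have /mdeg1P[j /eqP->] : mdeg m == 1%N.
    by rewrite eqn_leq -ltnS lt2 lt0n mdeg_eq0.
  rewrite (bigD1 j) //= eqxx mulr1 big1 ?addr0 // => i ne_ij.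
  by rewrite eq_mnm1 (negPf ne_ij) mulr0.
rewrite big1 // => i _; case: eqP => [Em|_]; rewrite ?mulr0 //.
by move: ge2; rewrite -Em mdeg1.
Qed.

(** [pcomp] computes a coefficient of degree d from the terms of [s] of degree at most d. In degree
    0 only the constant term of [s] is left, whatever [g] is; in degree 1 only the affine part of
    [s] is left. *)
Lemma pcomp_coeff0 (R : comNzRingType) n k (s : pser n R)
    (g : n.-tuple (pser k R)) : pcomp s g 0%MM = s 0%MM.
Proof.
have E1 : ptrunc s 1 = (s 0%MM)%:MP.
  apply/mpolyP => m; rewrite mcoeff_ptrunc mcoeffC ltnS leqn0 mdeg_eq0.
  by case: eqP => [->|]; rewrite ?mulr1 ?mulr0.
by rewrite /pcomp mdeg0 E1 comp_mpolyC mcoeffC eqxx mulr1.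
Qed.

Lemma pcomp_coeff1 (R : comNzRingType) n k (s : pser n R)
    (g : n.-tuple (pser k R)) (j : 'I_k) :
  pcomp s g U_(j)%MM = \sum_(i < n) s U_(i)%MM * tnth g i U_(j)%MM.
Proof.
rewrite /pcomp mdeg1 ptrunc2E comp_mpolyD comp_mpolyC mcoeffD mcoeffC.
rewrite mnm1_eq0 mulr0 add0r (raddf_sum (comp_mpoly _)) raddf_sum /=.
apply: eq_bigr => i _; rewrite comp_mpolyZ mcoeffZ comp_mpolyXU -tnth_nth tnth_mktuple.
by rewrite mcoeff_ptrunc mdeg1.
Qed.

(** * Integrality of the coefficients of the multiplication series *)

Section CoefficientSubring.
Variables (R : comNzRingType) (P : R -> Prop).
Hypotheses (P0 : P 0) (P1 : P 1).
Hypothesis PD : forall x y, P x -> P y -> P (x + y).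
Hypothesis PM : forall x y, P x -> P y -> P (x * y).

Let sum_closed (I : Type) (r : seq I) (Q : pred I) (F : I -> R) :
  (forall i, Q i -> P (F i)) -> P (\sum_(i <- r | Q i) F i).
Proof. by move=> PF; apply: big_ind. Qed.

Let mpolyM_closed n (p q : {mpoly R[n]}) :
  (forall m, P p@_m) -> (forall m, P q@_m) -> forall m, P (p * q)@_m.
Proof. by move=> Pp Pq m; rewrite mcoeffM; apply: sum_closed => i _; apply: PM. Qed.

Lemma pcomp_closed n k (s : pser n R) (g : n.-tuple (pser k R)) :
  (forall m, P (s m)) -> (forall i m, P (tnth g i m)) ->
  forall m, P (pcomp s g m).
Proof.
move=> Ps Pg m; rewrite /pcomp comp_mpolyE raddf_sum /=.
have Pone (m' : 'X_{1..k}) : P (1 : {mpoly R[k]})@_m'.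
  by rewrite mcoeff1; case: (_ == _).
have Ptr n' (t : pser n' R) b m' : (forall m'', P (t m'')) -> P (ptrunc t b)@_m'.
  by move=> Pt; rewrite mcoeff_ptrunc; case: ifP.
apply: sum_closed => m1 _; rewrite mcoeffZ; apply: PM; first exact: Ptr.
pose Q (p : {mpoly R[k]}) := forall m', P p@_m'.
suff: Q (\prod_(i < n) tnth [tuple ptrunc (tnth g i) (mdeg m).+1 | i < n] i ^+ m1 i).
  exact.
apply: big_ind => [|p q|i _]; [exact: Pone|exact: mpolyM_closed|rewrite /Q].
 rewrite tnth_mktuple.
elim: (m1 i) => [|e IH] //; rewrite exprS; apply: mpolyM_closed => // m'.
exact: Ptr.
Qed.

(** With [P] taken as membership in the valuation ring of [K], this places the coefficients of [[l]]
    in Z_l. *)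
Lemma fgl_mult_closed (F1 F2 : pser 4 R) k :
  (forall m, P (F1 m)) -> (forall m, P (F2 m)) ->
  (forall m, P ((fgl_mult F1 F2 k).1 m)) /\ (forall m, P ((fgl_mult F1 F2 k).2 m)).
Proof.
move=> PF1 PF2; rewrite /fgl_mult; elim: k.-1 => [|n [IH1 IH2]] /=.
  by split=> m; rewrite /pvar /of_mpoly mcoeffX; case: (_ == _).
have Pvar (i : 'I_2) m : P (pvar R i m).
  by rewrite /pvar /of_mpoly mcoeffX; case: (_ == _).
by split; apply: pcomp_closed => // i m; case: i => [[|[|[|[|//]]]] /= ?];
  rewrite /tnth /=.
Qed.

End CoefficientSubring.

(** * Linear part of the multiplication series *)

Lemma ord2P (j : 'I_2) : j = @Ordinal 2 0 isT \/ j = @Ordinal 2 1 isT.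
Proof. by case: j => [[|[|//]]] ?; [left|right]; apply: val_inj. Qed.

Lemma pvar_coeff1 (R : comNzRingType) n (i j : 'I_n) :
  pvar R i U_(j)%MM = (i == j)%:R.
Proof. by rewrite /pvar /of_mpoly mcoeffXU. Qed.

Lemma pvar_coeff0 (R : comNzRingType) n (i : 'I_n) : pvar R i 0%MM = 0.
Proof. by rewrite /pvar /of_mpoly mcoeffX mnm1_eq0. Qed.

Section FglLinearPart.
Variables (R : comNzRingType) (F1 F2 : pser 4 R).
Hypothesis hF : is_fgl2 F1 F2.

Let Fi (i : 'I_2) := if i == 0%N :> nat then F1 else F2.

Lemma fgl2_coeff0 i : Fi i 0%MM = 0.
Proof. by have [/(_ i 0%MM) + _ _ _] := hF; rewrite pcomp_coeff0 pvar_coeff0. Qed.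

(** The unit laws F(X, 0) = X and F(0, Y) = Y, read in degree 1, force the linear part of F to be X
    + Y. *)
Lemma fgl2_coeff1 (a b c d : pser 2 R) (i j : 'I_2) :
  pcomp (Fi i) [tuple a; b; c; d] U_(j)%MM =
  (if i == 0%N :> nat then a else b) U_(j)%MM
  + (if i == 0%N :> nat then c else d) U_(j)%MM.
Proof.
have [hl hr _ _] := hF.
have z1 (k : 'I_2) : (@pzero R 2) U_(k)%MM = 0 by [].
have:= (hl i U_(@Ordinal 2 0 isT)%MM, hl i U_(@Ordinal 2 1 isT)%MM,
        hr i U_(@Ordinal 2 0 isT)%MM, hr i U_(@Ordinal 2 1 isT)%MM).
rewrite !pcomp_coeff1 -/(Fi i) !big_ord_recl !big_ord0.
rewrite /tnth /= !pvar_coeff1 !z1 /= !(mulr0, mulr1, addr0, add0r).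
move=> [[[-> ->] ->] ->].
by case: (ord2P i) => ->; rewrite /= !(mul0r, mul1r, addr0, add0r).
Qed.

Lemma fgl_mult_coeff0 n (i : 'I_2) :
  (if i == 0%N :> nat then (fgl_mult F1 F2 n).1 else (fgl_mult F1 F2 n).2) 0%MM = 0.
Proof.
rewrite /fgl_mult; case: n.-1 => [|k] /=.
  by case: ifP => _; rewrite pvar_coeff0.
by have := fgl2_coeff0 i; rewrite /Fi; case: ifP => _; rewrite pcomp_coeff0.
Qed.

(** Induction from the linear part X + Y of F. The bound on [n] matters: [fgl_mult] uses [n.-1], so
    index 0 also gives [1]. *)
Lemma fgl_mult_coeff1 n (i j : 'I_2) : (0 < n)%N ->
  (if i == 0%N :> nat then (fgl_mult F1 F2 n).1 else (fgl_mult F1 F2 n).2) U_(j)%MM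
  = (i == j)%:R *+ n.
Proof.
move=> n_gt0; rewrite /fgl_mult -{3}(prednK n_gt0).
elim: n.-1 => [|k IH] /=.
  by rewrite mulr1n; case: (ord2P i) => -> /=; rewrite pvar_coeff1.
have := fgl2_coeff1 (pvar R (@Ordinal 2 0 isT)) (pvar R (@Ordinal 2 1 isT))
  (fgl_mult_aux F1 F2 k).1 (fgl_mult_aux F1 F2 k).2 i j.
rewrite (mulrS _ k.+1) -IH /Fi.
by case: (ord2P i) => -> /= ->; rewrite pvar_coeff1.
Qed.
End FglLinearPart.

(** * Bivariate monomials and the leading matrix modulo l *)

Definition mnm2 (i j : nat) : 'X_{1..2} :=
  (U_(@Ordinal 2 0 isT) *+ i + U_(@Ordinal 2 1 isT) *+ j)%MM.

Lemma mnm2E0 i j : mnm2 i j (@Ordinal 2 0 isT) = i.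
Proof. by rewrite mnmDE !mulmnE !mnm1E /= mul1n mul0n addn0. Qed.

Lemma mnm2E1 i j : mnm2 i j (@Ordinal 2 1 isT) = j.
Proof. by rewrite mnmDE !mulmnE !mnm1E /= mul1n mul0n. Qed.

Lemma mnm2_eta (m : 'X_{1..2}) :
  m = mnm2 (m (@Ordinal 2 0 isT)) (m (@Ordinal 2 1 isT)).
Proof. by apply/mnmP => k; case: (ord2P k) => ->; rewrite ?mnm2E0 ?mnm2E1. Qed.

Lemma mnm2_eq i j i' j' : (mnm2 i j == mnm2 i' j') = (i == i') && (j == j').
Proof.
apply/eqP/andP => [E|[/eqP-> /eqP->]//].
by split; apply/eqP; [rewrite -(mnm2E0 i j) E mnm2E0 | rewrite -(mnm2E1 i j) E mnm2E1].
Qed.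

Lemma mnm2_0 : mnm2 0 0 = 0%MM.
Proof. by rewrite /mnm2 !mulm0n addm0. Qed.

Lemma mnm2_le (k : 'X_{1..2}) i j : (k <= mnm2 i j)%MM ->
  (k (@Ordinal 2 0 isT) <= i)%N /\ (k (@Ordinal 2 1 isT) <= j)%N.
Proof.
move/mnm_lepP => le.
by have := (le (@Ordinal 2 0 isT), le (@Ordinal 2 1 isT)); rewrite mnm2E0 mnm2E1; case.
Qed.

(** In the Cauchy product at [m], every proper divisor of the monomial contributes zero through [f],
    so only the constant term of [a] meets [f m]. *)
Lemma pmul_lead (R : comNzRingType) n (a f : pser n R) (m : 'X_{1..n}) :
  (forall k : 'X_{1..n}, (k <= m)%MM -> k != m -> f k = 0) ->
  pmul a f m = a 0%MM * f m.
Proof.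
move=> f0; rewrite /pmul mcoeffM.
have d0 : (mdeg (0%MM : 'X_{1..n}) < (mdeg m).+1)%N by rewrite mdeg0.
rewrite (bigD1 (BMultinom d0, BMultinom (ltnSn (mdeg m)))) /=; last by rewrite add0m.
rewrite !mcoeff_ptrunc mdeg0 ltnSn /= big1 ?addr0 // => -[k1 k2] /= /andP[/eqP Em ne].
rewrite !mcoeff_ptrunc !bmdeg f0 ?mulr0 //; first by rewrite {2}Em lem_addl.
apply: contra ne => /eqP E2; rewrite -pair_eqE /pair_eq -!val_eqE /= E2 eqxx andbT.
by move/eqP: Em; rewrite E2 -{1}[m]add0m eqm_add2r eq_sym.
Qed.

(* Modulo (f, g) the coefficients of [Z1^i Z2^j], [i, j < q], are well defined;
   if the leading matrix were singular, so would be a combination of those of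
   [Z1^q] and [Z2^q], and the quotient would have dimension at least [q^2 + 1]. *)
Lemma quot_dim_leading_matrix (F : finFieldType) (q : nat) (f g : pser 2 F) :
  (0 < q)%N -> f 0%MM = 0 -> g 0%MM = 0 ->
  (forall m, f m != 0 -> (q %| m (@Ordinal 2 0 isT))%N /\ (q %| m (@Ordinal 2 1 isT))%N) ->
  (forall m, g m != 0 -> (q %| m (@Ordinal 2 0 isT))%N /\ (q %| m (@Ordinal 2 1 isT))%N) ->
  quot_dim f g (q ^ 2) ->
  f (mnm2 q 0) * g (mnm2 0 q) != f (mnm2 0 q) * g (mnm2 q 0).
Proof.
move=> q_gt0 f0 g0 fq gq [e [span _]]; apply/eqP => det0.
(* A nonzero vector killed by both rows of the singular matrix: a nonzero row rotated by a right
   angle, the vanishing determinant taking care of the other row; any vector if both rows vanish. *)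
have [c [d [cd_neq0 cdf cdg]]] : exists c d : F, [/\ (c != 0) || (d != 0),
    c * f (mnm2 q 0) + d * f (mnm2 0 q) = 0 & c * g (mnm2 q 0) + d * g (mnm2 0 q) = 0].
  have [/andP[/eqP fa0 /eqP fb0]|fn0] :=
    boolP ((f (mnm2 q 0) == 0) && (f (mnm2 0 q) == 0)); last first.
    exists (f (mnm2 0 q)), (- f (mnm2 q 0)); rewrite oppr_eq0 -negb_and andbC fn0.
    by rewrite !mulNr [X in _ - X]mulrC subrr det0 subrr.
  have [/andP[/eqP ga0 /eqP gb0]|gn0] :=
    boolP ((g (mnm2 q 0) == 0) && (g (mnm2 0 q) == 0)).
    by exists 1, 0; rewrite oner_neq0 fa0 fb0 ga0 gb0 !mulr0 addr0.
  exists (g (mnm2 0 q)), (- g (mnm2 q 0)); rewrite oppr_eq0 -negb_and andbC gn0.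
  by rewrite fa0 fb0 !mulr0 addr0 mulNr [X in _ - X]mulrC subrr.
(* Among the divisors of Z1^i Z2^j with i, j < q, only 1 has both exponents divisible by q, and [f],
   [g] have no constant term. *)
have ideal_box i j h : (i < q)%N -> (j < q)%N -> in_ideal2 f g h -> h (mnm2 i j) = 0.
  move=> ltiq ltjq [a [b ->]].
  have low (s : pser 2 F) : s 0%MM = 0 ->
      (forall m, s m != 0 ->
         (q %| m (@Ordinal 2 0 isT))%N /\ (q %| m (@Ordinal 2 1 isT))%N) ->
      forall k, (k <= mnm2 i j)%MM -> s k = 0.
    move=> s0 sq k /mnm2_le[lei lej]; apply: contra_eq s0 => /[dup] sk /sq[].
    rewrite /dvdn !modn_small ?(leq_ltn_trans lei) ?(leq_ltn_trans lej) //.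
    by move=> /eqP k0 /eqP k1; rewrite (mnm2_eta k) k0 k1 mnm2_0 in sk.
  have [lowf lowg] := (low f f0 fq, low g g0 gq).
  rewrite !pmul_lead => [|k le _|k le _]; [|exact: lowg|exact: lowf].
  by rewrite lowf ?lowg ?lepm_refl // !mulr0 addr0.
(* At Z1^q and Z2^q the coefficients of a f + b g are those of a_0 f + b_0 g, so the functional
   [(c, d)] kills the ideal. *)
have ideal_tip h : in_ideal2 f g h -> c * h (mnm2 q 0) + d * h (mnm2 0 q) = 0.
  move=> [a [b hE]].
  have dvd_le i : (i <= q)%N -> (q %| i)%N -> i = 0%N \/ i = q.
    case: i => [|i] leiq dvd; [by left | right].
    by apply/eqP; rewrite eqn_leq leiq dvdn_leq.
  have low0 (s : pser 2 F) : s 0%MM = 0 ->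
      (forall m, s m != 0 ->
         (q %| m (@Ordinal 2 0 isT))%N /\ (q %| m (@Ordinal 2 1 isT))%N) ->
      (forall k, (k <= mnm2 q 0)%MM -> k != mnm2 q 0 -> s k = 0) /\
      (forall k, (k <= mnm2 0 q)%MM -> k != mnm2 0 q -> s k = 0).
    move=> s0 sq; split=> k /mnm2_le[lei lej] ne; apply/eqP/negPn/negP => sk; case: (sq _ sk).
      move=> /(dvd_le _ lei) E0 _; move: lej; rewrite leqn0 => /eqP E1.
      move: sk ne; rewrite (mnm2_eta k) E1.
      by case: E0 => ->; rewrite ?mnm2_0 ?eqxx ?s0 ?eqxx.
    move=> _ /(dvd_le _ lej) E1; move: lei; rewrite leqn0 => /eqP E0.
    move: sk ne; rewrite (mnm2_eta k) E0.
    by case: E1 => ->; rewrite ?mnm2_0 ?eqxx ?s0 ?eqxx.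
  have [fa fb] := low0 f f0 fq; have [ga gb] := low0 g g0 gq.
  rewrite !hE !pmul_lead //.
  rewrite !mulrDr !(mulrCA c) !(mulrCA d) addrACA -!mulrDr cdf cdg.
  by rewrite !mulr0 addr0.
(* The index set of q^2 + 1 functionals vanishing on the ideal: the coefficients in the box and, at
   [None], the combination given by [(c, d)]. [Phi] evaluates them on combinations of the q^2
   generators. *)
pose T : finType := option ('I_q * 'I_q).
pose Phi (x : {ffun 'I_(q ^ 2) -> F}) : {ffun T -> F} := [ffun o : option ('I_q * 'I_q) =>
  if o is Some ij then \sum_k x k * e k (mnm2 ij.1 ij.2)
  else c * (\sum_k x k * e k (mnm2 q 0)) + d * (\sum_k x k * e k (mnm2 0 q))].
have Phi_surj u : u \in codom Phi.
  have [x [y xy]] : exists x y, c * x + d * y = u None.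
    have [c0|c_neq0] := eqVneq c 0.
      exists 0, (u None / d); rewrite mulr0 add0r mulrCA divff ?mulr1 //.
      by move: cd_neq0; rewrite c0 eqxx.
    by exists (u None / c), 0; rewrite mulr0 addr0 mulrCA divff ?mulr1.
  (* A series with prescribed functionals. [insub] succeeds exactly on exponents below q; outside
     the box only the values at Z1^q and Z2^q matter, and Z2^q receives the default [y]. *)
  pose h : pser 2 F := fun m =>
    match insub (m (@Ordinal 2 0 isT)), insub (m (@Ordinal 2 1 isT)) with
    | Some i, Some j => u (Some (i, j))
    | _, _ => if m == mnm2 q 0 then x else y end.
  have [a aP] := span h; apply/codomP; exists (finfun a); apply/ffunP => o.
  rewrite ffunE.
  case: o => [[i j]|] /=.
    under eq_bigr do rewrite ffunE.
    have /eqP := ideal_box _ _ _ (ltn_ord i) (ltn_ord j) aP.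
    by rewrite subr_eq0 /h mnm2E0 mnm2E1 !valK => /eqP.
  under eq_bigr do rewrite ffunE; under [in d * _]eq_bigr do rewrite ffunE.
  have /eqP := ideal_tip _ aP; rewrite !mulrBr addrACA -opprD subr_eq0 => /eqP <-.
  rewrite /h !mnm2E0 !mnm2E1 insubF ?ltnn // -xy eqxx mnm2_eq.
  by rewrite (ltn_eqF q_gt0) /=; case: insub.
(* Dimensions are compared by counting: over a finite field nothing maps a set of size |F|^(q^2)
   onto one of size |F|^(q^2 + 1). *)
have : (#|{ffun T -> F}| <= #|{ffun 'I_(q ^ 2) -> F}|)%N.
  apply: leq_trans (leq_image_card Phi _).
  by apply/subset_leq_card/subsetP => u _; rewrite Phi_surj.
rewrite !card_ffun card_option card_prod !card_ord mulnn leq_exp2l ?ltnn //.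
exact: card_finNzRing_gt1.
Qed.

(** From k C(l^n, k) = l^n C(l^n - 1, k - 1): if C(l^n, k) were prime to l, then l^n would divide
    k. *)
Lemma dvdn_prime_exp_bin l n k :
  prime l -> (0 < k < l ^ n)%N -> (l %| 'C(l ^ n, k))%N.
Proof.
move=> lP /andP[k_gt0 ltk]; apply/negPn/negP => ndvd.
have /dvdn_leq : (l ^ n %| k)%N.
  rewrite -(@Gauss_dvdl _ k 'C(l ^ n, k)) ?coprimeXl ?prime_coprime //.
  have := mul_bin_diag (l ^ n) k.-1; rewrite prednK // => <-.
  exact: dvdn_mulr.
by move=> /(_ k_gt0); rewrite leqNgt ltk.
Qed.

(** * Calculus of valuation bounds *)

Section Valuation.
Variables (L : fieldType) (v : L -> rat).
Hypothesis vM : forall x y : L, x != 0 -> y != 0 -> v (x * y) = v x + v y.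
Hypothesis vgeD : forall x y q, vge v x q -> vge v y q -> vge v (x + y) q.

Lemma vge0 a : vge v 0 a. Proof. by rewrite /vge eqxx. Qed.

(** Strict bounds become weak bounds at a larger rational, so the strict rules for sums and products
    follow from the weak ones. At zero, of infinite valuation, any larger rational serves; [a + 1]
    is chosen. *)
Lemma vgtP x a : vgt v x a -> exists2 b, a < b & vge v x b.
Proof.
rewrite /vgt /vge; case: eqP => [_ _|_ /= lt]; first by exists (a + 1); rewrite ?ltrDl.
by exists (v x).
Qed.

Lemma vge_gt x a b : a < b -> vge v x b -> vgt v x a.
Proof. by rewrite /vgt /vge => ltab /orP[->//|/(lt_le_trans ltab)->]; rewrite orbT. Qed.

Lemma vgeW x a b : a <= b -> vge v x b -> vge v x a.
Proof. by rewrite /vge => leab /orP[->//|/(le_trans leab)->]; rewrite orbT. Qed.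

Lemma vgtW x a b : a <= b -> vgt v x b -> vgt v x a.
Proof. by move=> leab /vgtP[d /(le_lt_trans leab)]; apply: vge_gt. Qed.

Lemma vgt_ge x a : vgt v x a -> vge v x a.
Proof. by move=> /vgtP[b /ltW]; apply: vgeW. Qed.

Lemma vgtD x y a : vgt v x a -> vgt v y a -> vgt v (x + y) a.
Proof.
move=> /vgtP[b ltab xb] /vgtP[d ltad yd].
apply: (@vge_gt _ _ (Num.min b d)); first by rewrite lt_min ltab.
by apply: vgeD; [apply: vgeW xb | apply: vgeW yd]; rewrite ge_min lexx ?orbT.
Qed.

Lemma v_one : v 1 = 0.
Proof. by apply: (addrI (v 1)); rewrite -vM ?oner_neq0 // mulr1 addr0. Qed.

Lemma vgeM x y a b : vge v x a -> vge v y b -> vge v (x * y) (a + b).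
Proof.
rewrite /vge; have [->|x0] := eqVneq x 0; first by rewrite mul0r eqxx.
have [->|y0] := eqVneq y 0; first by rewrite mulr0 eqxx.
by rewrite mulf_eq0 (negPf x0) (negPf y0) /= vM //; apply: lerD.
Qed.

Lemma vgtM x y a b : vge v x a -> vgt v y b -> vgt v (x * y) (a + b).
Proof.
move=> xa /vgtP[d ltbd yd]; apply: vge_gt (vgeM xa yd).
by rewrite ltrD2l.
Qed.

Lemma vge_one : vge v 1 0.
Proof. by rewrite /vge v_one lexx orbT. Qed.

Lemma vgeN x a : vge v x a -> vge v (- x) a.
Proof.
have vN1 : v (-1) = 0.
  have : v (-1) + v (-1) = 0.
    by rewrite -vM ?oppr_eq0 ?oner_neq0 // mulrNN mulr1 v_one.
  by move/eqP; rewrite -mulr2n mulrn_eq0 => /eqP.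
rewrite /vge oppr_eq0; have [//|x0] := eqVneq x 0.
by rewrite -mulN1r vM ?oppr_eq0 ?oner_neq0 // vN1 add0r.
Qed.

Lemma vgtN x a : vgt v x a -> vgt v (- x) a.
Proof. by move=> /vgtP[b ltab /vgeN]; apply: vge_gt. Qed.

Lemma vgeB x y a : vge v x a -> vge v y a -> vge v (x - y) a.
Proof. by move=> xa ya; apply: vgeD => //; apply: vgeN. Qed.

Lemma vgtB x y a : vgt v x a -> vgt v y a -> vgt v (x - y) a.
Proof. by move=> xa ya; apply: vgtD => //; apply: vgtN. Qed.

Lemma vgt0 a : vgt v 0 a. Proof. by rewrite /vgt eqxx. Qed.

Lemma vgt_sum (I : Type) (r : seq I) (P : pred I) (F : I -> L) a :
  (forall i, P i -> vgt v (F i) a) -> vgt v (\sum_(i <- r | P i) F i) a.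
Proof.
move=> Fa; apply: (big_ind (fun x => vgt v x a)) => //; first exact: vgt0.
by move=> x y; apply: vgtD.
Qed.

Lemma vgeX x a n : vge v x a -> vge v (x ^+ n) (a *+ n).
Proof.
move=> xa; elim: n => [|n IH]; first exact: vge_one.
by rewrite exprS mulrS; apply: vgeM.
Qed.

Lemma vge_nat n : vge v n%:R 0.
Proof.
elim: n => [|n IH]; first exact: vge0.
by rewrite -natr1; apply: vgeD => //; apply: vge_one.
Qed.

Lemma vgt_mul_unit x y a : ~~ vgt v x 0 -> vgt v (x * y) a -> vgt v y a.
Proof.
rewrite /vgt negb_or -leNgt => /andP[x0 vx0]; rewrite mulf_eq0 (negPf x0) /=.
have [//|y0 /=] := eqVneq y 0; rewrite vM // => lt; apply: lt_le_trans lt _.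
by rewrite gerDr.
Qed.

Lemma vgt_root x a n : vgt v (x ^+ n) (a *+ n) -> vgt v x a.
Proof.
case: n => [|n]; first by rewrite expr0 mulr0n /vgt oner_eq0 v_one ltxx.
rewrite /vgt expf_eq0 /=; have [//|x0 /=] := eqVneq x 0.
suff -> : v (x ^+ n.+1) = v x *+ n.+1 by rewrite ltr_pMn2r.
by elim: n => [|n IH] //; rewrite exprS vM ?expf_neq0 // IH [RHS]mulrS.
Qed.

(** The witness is the minimum of the two valuations, zero counting as infinite; the last conjunct
    says that it is attained. *)
Lemma vgt_pair_min x y : (x != 0) || (y != 0) ->
  exists a, [/\ vge v x a, vge v y a & ~~ (vgt v x a && vgt v y a)].
Proof.
rewrite /vge /vgt; have [_|x0] := eqVneq x 0; have [_|y0] := eqVneq y 0 => //= _.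
- by exists (v y); rewrite lexx ltxx.
- by exists (v x); rewrite lexx ltxx.
case: (lerP (v x) (v y)) => le; first by exists (v x); rewrite lexx ltxx.
by exists (v y); rewrite lexx ltxx andbF (ltW le).
Qed.

Lemma vge_monomial n (z : 'I_n -> L) c (m : 'X_{1..n}) :
  (forall i, vge v (z i) c) -> vge v (\prod_(i < n) z i ^+ m i) (c *+ mdeg m).
Proof.
move=> zc; rewrite mdegE; elim/big_rec2: _ => [|i a b _ H]; first exact: vge_one.
by rewrite mulrnDr; apply: vgeM => //; apply: vgeX.
Qed.

(** The difference telescopes into products with one factor z_i - w_i and deg m - 1 factors of
    valuation at least c. The form [e - c + c *+ mdeg m] is additive enough for induction and covers
    degree 0, where the difference is 0. *)
Lemma vge_monomialB n (z w : 'I_n -> L) c e (m : 'X_{1..n}) :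
  (forall i, vge v (z i) c) -> (forall i, vge v (w i) c) ->
  (forall i, vge v (z i - w i) e) ->
  vge v (\prod_(i < n) z i ^+ m i - \prod_(i < n) w i ^+ m i) (e - c + c *+ mdeg m).
Proof.
move=> zc wc zwe.
pose Q (A B : L) k :=
  [/\ vge v A (c *+ k), vge v B (c *+ k) & vge v (A - B) (e - c + c *+ k)].
have Q1 : Q 1 1 0%N by split; rewrite ?subrr ?vge0 ?vge_one.
have QM A B k A' B' k' : Q A B k -> Q A' B' k' -> Q (A * A') (B * B') (k + k')%N.
  move=> [hA hB hAB] [hA' hB' hAB']; split; rewrite mulrnDr; try exact: vgeM.
  have -> : A * A' - B * B' = A * (A' - B') + (A - B) * B'.
    by rewrite mulrBr mulrBl addrA subrK.
  apply: vgeD; last by rewrite addrA; apply: vgeM.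
  by rewrite addrCA; apply: vgeM.
suff [] : Q (\prod_(i < n) z i ^+ m i) (\prod_(i < n) w i ^+ m i) (mdeg m) by [].
rewrite mdegE; elim/big_rec3: _ => // i A B k _; apply: (QM).
elim: (m i) => [|j IH] //; rewrite !exprS -add1n; apply: (QM) => //.
by split; rewrite ?mulr1n ?subrK.
Qed.

Lemma meval_ptrunc n (s : pser n L) N (z : 'I_n -> L) :
  (ptrunc s N).@[z] = \sum_(m : 'X_{1..n < N}) s m * \prod_(i < n) z i ^+ m i.
Proof.
rewrite /ptrunc raddf_sum /=; apply: eq_bigr => m _.
by rewrite mevalZ mevalX.
Qed.
End Valuation.

Lemma mdeg_mnm2 i j : mdeg (mnm2 i j) = (i + j)%N.
Proof. by rewrite mdegD !mdegMn !mdeg1 !mul1n. Qed.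

(** * Estimates for series that modulo l depend only on Z1^q and Z2^q *)

Section FrobeniusEstimates.
Variables (L : fieldType) (v : L -> rat).
Hypothesis vM : forall x y : L, x != 0 -> y != 0 -> v (x * y) = v x + v y.
Hypothesis vgeD : forall x y q, vge v x q -> vge v y q -> vge v (x + y) q.
Variables (l e : nat).
Hypotheses (lP : prime l) (vl : vge v l%:R 1).
Local Notation q := (l ^ e)%N.
Local Notation o0 := (@Ordinal 2 0 isT).
Local Notation o1 := (@Ordinal 2 1 isT).

(** Expand (y + t)^q with t = x - y. A middle term gains 1 from its binomial coefficient and more
    than d from y^(q-i) t^i; the last term t^q has valuation at least q d. *)
Lemma vgt_frobeniusB x y c d :
  0 < c -> c < d -> 1 + c <= c *+ q -> vge v y c -> vge v (x - y) d ->
  vgt v (x ^+ q - y ^+ q) (1 + d).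
Proof.
move=> c_gt0 ltcd leq yc; set t := x - y => dd.
have -> : x = y + t by rewrite addrC subrK.
have d_gt0 := lt_trans c_gt0 ltcd.
have q_gt0 : (0 < q)%N by rewrite expn_gt0 prime_gt0.
(* The assumption on c reads 1 <= c (q - 1). This forces q > 1, and c < d then makes the inequality
   strict for d. *)
have ltdq : 1 + d < d *+ q.
  move: leq; rewrite -(prednK q_gt0) !mulrS [1 + c]addrC [1 + d]addrC lerD2l ltrD2l => le.
  apply: le_lt_trans (le) _; rewrite ltrMn2r ltcd andbT lt0n.
  by apply: contraTneq le => ->; rewrite mulr0n -ltNge ltr01.
have expand n : (y + t) ^+ n.+1 - y ^+ n.+1 =
    t ^+ n.+1 + \sum_(i < n) y ^+ (n.+1 - i.+1) * t ^+ i.+1 *+ 'C(n.+1, i.+1).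
  rewrite exprDn big_ord_recl big_ord_recr /= subn0 expr0 mulr1 bin0 mulr1n.
  by rewrite [LHS]addrC addKr [LHS]addrC /bump leq0n add1n subnn expr0 mul1r binn mulr1n.
have := expand q.-1; rewrite prednK // => ->.
apply: vgtD => //; first by apply: vge_gt ltdq _; apply: vgeX.
apply: vgt_sum => // i _; rewrite -mulr_natr.
have lti : (i.+1 < q)%N by rewrite -[ltnRHS]prednK // ltnS.
have /dvdnP[k ->] := dvdn_prime_exp_bin (n := e) (k := i.+1) lP lti.
apply: (@vge_gt _ _ _ _ ((c *+ (q - i.+1) + d *+ i.+1) + (0 + 1))).
  rewrite add0r addrC ltrD2r mulrS addrCA ltrDl.
  apply: ltr_wpDr; first by rewrite mulrn_wge0 // ltW.
  by rewrite pmulrn_rgt0 // subn_gt0.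
rewrite natrM; do 2 (apply: vgeM => //); try exact: vge_nat.
all: exact: vgeX.
Qed.

Variable s : pser 2 L.
Hypothesis s0 : s 0%MM = 0.
Hypothesis s_ge0 : forall m, vge v (s m) 0.
Hypothesis s_ge1 : forall m : 'X_{1..2}, ~~ ((q %| m o0) && (q %| m o1))%N -> vge v (s m) 1.

(** When c q < 1 + c the terms at Z1^q and Z2^q dominate: other monomials in the q-th powers have
    degree at least 2 q, and each remaining term has valuation at least 1 + c thanks to its
    coefficient. *)
Lemma vgt_leading_part (z : 'I_2 -> L) c N :
  (forall i, vge v (z i) c) -> 0 < c -> c *+ q < 1 + c -> (q < N)%N ->
  vgt v ((ptrunc s N).@[z] - (s (mnm2 q 0) * z o0 ^+ q + s (mnm2 0 q) * z o1 ^+ q))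
        (c *+ q).
Proof.
move=> zc c_gt0 ltcq ltqN; have q_gt0 : (0 < q)%N by rewrite expn_gt0 prime_gt0.
have d0 : (mdeg (mnm2 q 0) < N)%N by rewrite mdeg_mnm2 addn0.
have d1 : (mdeg (mnm2 0 q) < N)%N by rewrite mdeg_mnm2 add0n.
rewrite meval_ptrunc (bigD1 (BMultinom d0)) //= (bigD1 (BMultinom d1)) /=; last first.
  by rewrite -val_eqE /= mnm2_eq ?(ltn_eqF q_gt0) ?(gtn_eqF q_gt0).
have mon i j : \prod_(k < 2) z k ^+ mnm2 i j k = z o0 ^+ i * z o1 ^+ j.
  rewrite !big_ord_recl big_ord0 mulr1.
  have [-> ->] : ord0 = o0 /\ lift ord0 ord0 = o1 by split; apply: val_inj.
  by rewrite mnm2E0 mnm2E1.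
rewrite !mon !expr0 mulr1 mul1r addrA [X in vgt _ X]addrC addKr.
apply: vgt_sum => // m /andP[n0 n1].
have [ne0 ne1] : bmnm m != mnm2 q 0 /\ bmnm m != mnm2 0 q by [].
have [->|m_neq0] := eqVneq (bmnm m) 0%MM; first by rewrite s0 mul0r vgt0.
have dm : (0 < mdeg m)%N by rewrite lt0n mdeg_eq0.
have [/andP[/dvdnP[a Ea] /dvdnP[b Eb]]|ndvd] := boolP ((q %| m o0) && (q %| m o1))%N.
  apply: (@vge_gt _ _ _ _ (0 + c *+ mdeg m)); last by apply: vgeM => //; apply: vge_monomial.
  have := mnm2_eta m; rewrite Ea Eb => Em; rewrite add0r Em mdeg_mnm2 -mulnDl.
  rewrite ltr_pMn2l // ltn_Pmull //.
  have eqq k : (k * q == q)%N = (k == 1)%N by rewrite -{2}[q]mul1n eqn_pmul2r.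
  move: ne0 ne1 m_neq0; rewrite {}Em -mnm2_0 !mnm2_eq !eqq !muln_eq0.
  by rewrite (gtn_eqF q_gt0) !orbF; case: a b {Ea Eb} => [|[|a]] [|[|b]].
apply: (@vge_gt _ _ _ _ (1 + c *+ mdeg m)).
  apply: lt_le_trans ltcq _; by rewrite lerD2l -{1}[c]mulr1n ler_pMn2l.
by apply: vgeM => //; [apply: s_ge1 | apply: vge_monomial].
Qed.

(** A nonlinear term is either a monomial in the q-th powers, controlled by [vgt_frobeniusB], or has
    a coefficient of valuation at least 1 and degree at least 2, so that its difference has
    valuation at least 1 + d + c. *)
Lemma vgt_ptruncB (z w : 'I_2 -> L) c d N :
  (forall i, vge v (z i) c) -> (forall i, vge v (w i) c) ->
  (forall i, vge v (z i - w i) d) ->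
  0 < c -> c < d -> 1 + c <= c *+ q -> (1 < N)%N ->
  vgt v ((ptrunc s N).@[z] - (ptrunc s N).@[w]
         - (s U_(o0)%MM * (z o0 - w o0) + s U_(o1)%MM * (z o1 - w o1))) (1 + d).
Proof.
move=> zc wc zwd c_gt0 ltcd lecq ltN.
have q_gt0 : (0 < q)%N by rewrite expn_gt0 prime_gt0.
have [d0 d1] : (mdeg U_(o0) < N)%N /\ (mdeg U_(o1) < N)%N by rewrite !mdeg1.
rewrite !meval_ptrunc -sumrB; under eq_bigr do rewrite -mulrBr.
rewrite (bigD1 (BMultinom d0)) //= (bigD1 (BMultinom d1)) /=; last first.
  by rewrite -val_eqE /= eq_mnm1.
have mon (x : 'I_2 -> L) i : \prod_(k < 2) x k ^+ U_(i)%MM k = x i.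
  by rewrite -mevalX mevalXU.
rewrite !mon addrA [X in vgt _ X]addrC addKr.
apply: vgt_sum => // m /andP[n0 n1].
have [ne0 ne1] : bmnm m != U_(o0)%MM /\ bmnm m != U_(o1)%MM by [].
have [->|m_neq0] := eqVneq (bmnm m) 0%MM; first by rewrite s0 mul0r vgt0.
have dm : (1 < mdeg m)%N.
  rewrite ltn_neqAle lt0n mdeg_eq0 m_neq0 andbT eq_sym; apply/negP => /mdeg1P[i /eqP E].
  by move: ne0 ne1; rewrite E !eq_mnm1; case: (ord2P i) => ->.
have [/andP[/dvdnP[a Ea] /dvdnP[b Eb]]|ndvd] := boolP ((q %| m o0) && (q %| m o1))%N.
  have /vgtP[b0 lt0 ge0] := vgt_frobeniusB c_gt0 ltcd lecq (wc o0) (zwd o0).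
  have /vgtP[b1 lt1 ge1] := vgt_frobeniusB c_gt0 ltcd lecq (wc o1) (zwd o1).
  apply: (@vge_gt _ _ _ _ (0 + Num.min b0 b1)); first by rewrite add0r lt_min lt0.
  apply: vgeM => //.
  have mon' (x : 'I_2 -> L) :
      \prod_(i < 2) x i ^+ m i = \prod_(i < 2) (x i ^+ q) ^+ mnm2 a b i.
    apply: eq_bigr => i _; rewrite -exprM mulnC.
    by case: (ord2P i) => ->; rewrite ?Ea ?Eb ?mnm2E0 ?mnm2E1.
  have q0 (x : L) : vge v x c -> vge v (x ^+ q) 0.
    by move=> xc; rewrite -(mul0rn _ q); apply: vgeX => //; apply: vgeW xc; apply: ltW.
  rewrite !mon'.
  (* The q-th powers enter only as integral elements, hence the bound 0; the whole gain comes from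
     the difference of q-th powers. *)
  have := @vge_monomialB _ _ vM vgeD 2 (fun i => z i ^+ q) (fun i => w i ^+ q) 0
    (Num.min b0 b1) (mnm2 a b).
  rewrite subr0 mul0rn addr0; apply => i; try exact: q0.
  by case: (ord2P i) => ->; [apply: vgeW ge0 | apply: vgeW ge1];
    rewrite ge_min lexx ?orbT.
apply: (@vge_gt _ _ _ _ (1 + (d - c + c *+ mdeg m))).
  rewrite ltrD2l -addrA ltrDl addrC subr_gt0.
  by rewrite -{1}[c]mulr1n ltr_pMn2l.
by apply: vgeM => //; [apply: s_ge1 | apply: vge_monomialB].
Qed.
End FrobeniusEstimates.

(** * Reduction of integral elements to the residue field *)

Section Residue.
Variables (L : fieldType) (v : L -> rat).
Hypothesis vM : forall x y : L, x != 0 -> y != 0 -> v (x * y) = v x + v y.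
Hypothesis vgeD : forall x y q, vge v x q -> vge v y q -> vge v (x + y) q.
Variable l : nat.
Hypotheses (lP : prime l) (vl : vge v l%:R 1).

(** Bezout: if l did not divide n, then 1 = u l - w n would have positive valuation. *)
Lemma vgt_nat n : vgt v n%:R 0 -> (l %| n)%N.
Proof.
case: n => [|n] vn; first exact: dvdn0.
apply/negPn/negP; rewrite -prime_coprime // => /eqP co.
have [[u w] /= E] : {uw : nat * nat | (uw.1 * l = uw.2 * n.+1 + 1)%N}.
  case: (egcdnP n.+1 (prime_gt0 lP)) => u w E _.
  by exists (u, w); rewrite E co.
have : vgt v 1 0.
  have -> : 1 = (u * l)%:R - (w * n.+1)%:R :> L by rewrite E natrD addrC addKr.
  apply: vgtB => //; rewrite natrM -(addr0 0); apply: vgtM => //; try exact: vge_nat.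
  by apply: vge_gt vl; rewrite ltr01.
by rewrite /vgt oner_eq0 v_one // ltxx.
Qed.

Lemma vgt_natB m n : vgt v (m%:R - n%:R) 0 -> m%:R = n%:R :> 'F_l.
Proof.
wlog lenm : m n / (n <= m)%N => [wl|].
  have [/wl//|ltmn] := leqP n m; rewrite -opprB => /(vgtN vM).
  by rewrite opprK => /wl -> //; apply: ltnW.
rewrite -natrB // => /vgt_nat dvd; apply/eqP.
by rewrite -subr_eq0 -natrB // -(dvdn_pcharf (pchar_Fp lP)).
Qed.

(** Serves to identify the reductions of [[l]] that [fgl_height] and [fgl_exponent] choose
    independently. *)
Lemma reduces_to_inj a (c d : 'F_l) :
  reduces_to v a c -> reduces_to v a d -> c = d.
Proof.
rewrite /reduces_to => ac ad; have := vgtB vM vgeD ad ac.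
have -> : a - d%:R - (a - c%:R) = c%:R - d%:R :> L by ring.
by move/vgt_natB; rewrite !natr_Zp.
Qed.

Lemma reduces_to_eq0 a (c : 'F_l) : vgt v a 0 -> reduces_to v a c -> c = 0.
Proof. by move=> a0 /reduces_to_inj; apply; rewrite /reduces_to subr0. Qed.

(** By contraposition, an invertible leading matrix over ['F_l] lifts to a matrix whose determinant
    lies outside the maximal ideal. *)
Lemma reduces_to_det a b c d (a' b' c' d' : 'F_l) :
  vge v a 0 -> vge v b 0 ->
  reduces_to v a a' -> reduces_to v b b' ->
  reduces_to v c c' -> reduces_to v d d' ->
  vgt v (a * d - b * c) 0 -> a' * d' = b' * c'.
Proof.
move=> a0 b0 aa bb cc dd det.
have prod x y (x' y' : 'F_l) : vge v x 0 -> reduces_to v x x' -> reduces_to v y y' ->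
    vgt v (x * y - (x' * y')%N%:R) 0.
  move=> x0 xx yy; rewrite natrM.
  have -> : x * y - x'%:R * y'%:R = x * (y - y'%:R) + y'%:R * (x - x'%:R).
    by ring.
  by rewrite -(addr0 0); apply: vgtD => //; apply: vgtM => //; apply: vge_nat.
have := vgtB vM vgeD (prod _ _ _ _ b0 bb cc) (prod _ _ _ _ a0 aa dd).
move/(vgtD vgeD det).
have -> (x y z t : L) : x - y + (y - z - (x - t)) = t - z.
  by ring.
by move/vgt_natB; rewrite !natrM !natr_Zp.
Qed.
End Residue.

(** * Valuations of torsion points and of their differences *)

Section Torsion.
Variables (L : fieldType) (v : L -> rat).
Hypothesis vM : forall x y : L, x != 0 -> y != 0 -> v (x * y) = v x + v y.
Hypothesis vgeD : forall x y q, vge v x q -> vge v y q -> vge v (x + y) q.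
Variables (l e : nat).
Hypotheses (lP : prime l) (vl : vge v l%:R 1).
Local Notation q := (l ^ e)%N.
Local Notation o0 := (@Ordinal 2 0 isT).
Local Notation o1 := (@Ordinal 2 1 isT).

(** Cramer's rule: the determinant times [x] or [y] is an integral combination of the two forms, and
    the determinant is a unit. *)
Lemma vgt_det a b c d x y r :
  vge v a 0 -> vge v b 0 -> vge v c 0 -> vge v d 0 -> ~~ vgt v (a * d - b * c) 0 ->
  vgt v (a * x + b * y) r -> vgt v (c * x + d * y) r -> vgt v x r && vgt v y r.
Proof.
move=> a0 b0 c0 d0 det h1 h2.
have M s t : vge v s 0 -> vgt v t r -> vgt v (s * t) r.
  by move=> s0 tr; rewrite -(add0r r); apply: vgtM.
apply/andP; split; apply: (vgt_mul_unit vM det).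
  have -> : (a * d - b * c) * x = d * (a * x + b * y) - b * (c * x + d * y) by ring.
  by apply: vgtB => //; apply: M.
have -> : (a * d - b * c) * y = a * (c * x + d * y) - c * (a * x + b * y) by ring.
by apply: vgtB => //; apply: M.
Qed.

(** The series reduces modulo l to one in Z1^q and Z2^q. The bound is 1 rather than mere positivity
    because the coefficients will lie in Z_l, where the valuation takes integer values. *)
Definition frobenius_mod (s : pser 2 L) : Prop :=
  [/\ s 0%MM = 0, forall m, vge v (s m) 0 &
      forall m : 'X_{1..2}, ~~ ((q %| m o0) && (q %| m o1))%N -> vge v (s m) 1].

Variables f g : pser 2 L.
Hypotheses (fF : frobenius_mod f) (gF : frobenius_mod g).

(** If c q < 1 + c, the leading parts of [f] and [g] at [z] must have valuation above c q, since the
    full values vanish. Inverting the leading matrix gives v(z_i^q) > c q for both i, against the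
    minimality of c. *)
Lemma torsion_slope (z : 2.-tuple L) c :
  ~~ vgt v (f (mnm2 q 0) * g (mnm2 0 q) - f (mnm2 0 q) * g (mnm2 q 0)) 0 ->
  pser_eval_to v f z 0 -> pser_eval_to v g z 0 ->
  0 < c -> (forall i, vge v (tnth z i) c) ->
  ~~ (vgt v (tnth z o0) c && vgt v (tnth z o1) c) -> 1 + c <= c *+ q.
Proof.
move=> det tf tg c_gt0 zc min; rewrite leNgt; apply: contra min => ltq.
have lead (s : pser 2 L) : frobenius_mod s -> pser_eval_to v s z 0 ->
    vgt v (s (mnm2 q 0) * tnth z o0 ^+ q + s (mnm2 0 q) * tnth z o1 ^+ q) (c *+ q).
  move=> [s0 s_ge0 s_ge1] /(_ (c *+ q))[N0 /(_ (maxn N0 q.+1) (leq_maxl _ _))].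
  rewrite subr0 => tors.
  have lt : (q < maxn N0 q.+1)%N by rewrite leq_max ltnSn orbT.
  have est := vgt_leading_part vM vgeD lP s0 s_ge0 s_ge1 zc c_gt0 ltq lt.
  by have := vgtB vM vgeD tors est; rewrite opprB addrC subrK.
have [[_ f0 _] [_ g0 _]] := (fF, gF).
by have /andP[/(vgt_root vM)-> /(vgt_root vM)->] :=
  vgt_det (f0 _) (f0 _) (g0 _) (g0 _) det (lead f fF tf) (lead g gF tg).
Qed.

(* If [z] and [w] were distinct torsion points, comparing the series at them
   would make the linear term [l (z - w)] smaller than itself. *)
Lemma torsion_separated (z w : 2.-tuple L) c :
  v l%:R = 1 -> l%:R != 0 :> L ->
  f U_(o0)%MM = l%:R -> f U_(o1)%MM = 0 -> g U_(o0)%MM = 0 -> g U_(o1)%MM = l%:R ->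
  pser_eval_to v f z 0 -> pser_eval_to v g z 0 ->
  pser_eval_to v f w 0 -> pser_eval_to v g w 0 ->
  0 < c -> 1 + c <= c *+ q ->
  (forall i, vge v (tnth z i) c) -> (forall i, vgt v (tnth z i - tnth w i) c) ->
  z = w.
Proof.
move=> vl1 l_neq0 fU0 fU1 gU0 gU1 zf zg wf wg c_gt0 lecq zc zwc.
apply/eqP; rewrite eqEtuple; apply/forallP => i0; rewrite -subr_eq0; move: i0.
apply/forallP; apply/negPn/negP => neq.
have /(vgt_pair_min v)[d [d0 d1 min]] :
    (tnth z o0 - tnth w o0 != 0) || (tnth z o1 - tnth w o1 != 0).
  apply: contraR neq; rewrite negb_or !negbK => /andP[h0 h1].
  by apply/forallP => i; case: (ord2P i) => ->.
have ltcd : c < d.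
  by rewrite ltNge; apply: contra min => ledc; apply/andP; split;
    apply: vgtW ledc _; apply: zwc.
have zwd i : vge v (tnth z i - tnth w i) d by case: (ord2P i) => ->.
have wc i : vge v (tnth w i) c.
  rewrite -[tnth w i](subKr (tnth z i)); apply: vgeB => //.
  exact/vgt_ge/zwc.
have lin (s : pser 2 L) : frobenius_mod s ->
    pser_eval_to v s z 0 -> pser_eval_to v s w 0 ->
    vgt v (s U_(o0)%MM * (tnth z o0 - tnth w o0)
           + s U_(o1)%MM * (tnth z o1 - tnth w o1)) (1 + d).
  move=> [s0 s_ge0 s_ge1] /(_ (1 + d))[Nz hz] /(_ (1 + d))[Nw hw].
  (* The 2 keeps the linear terms inside the truncation. *)
  pose N := maxn 2 (maxn Nz Nw).
  have := hz N; rewrite /N !leq_max leqnn !orbT subr0 => /(_ isT) tz.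
  have := hw N; rewrite /N !leq_max leqnn !orbT subr0 => /(_ isT) tw.
  have ltN : (1 < N)%N by rewrite leq_max.
  have est := vgt_ptruncB vM vgeD lP vl s0 s_ge0 s_ge1 zc wc zwd c_gt0 ltcd lecq ltN.
  by have := vgtB vM vgeD (vgtB vM vgeD tz tw) est; rewrite opprB addrC subrK.
have cancel_l x : vgt v (l%:R * x) (1 + d) -> vgt v x d.
  rewrite /vgt mulf_eq0 (negPf l_neq0) /=; have [//|x0 /=] := eqVneq x 0.
  by rewrite vM // vl1 ltrD2l.
have := (lin f fF zf wf, lin g gF zg wg).
rewrite fU0 fU1 gU0 gU1 !mul0r addr0 add0r => -[/cancel_l h0 /cancel_l h1].
by rewrite h0 h1 in min.
Qed.
End Torsion.

(** * Wild inertia and the conclusion *)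

(** Both parts come from x - sigma x = - x (sigma x / x - 1). The second is the continuity of
    [sigma] that lets it preserve convergence to 0. *)
Lemma vgt_wild (L : fieldType) (v : L -> rat) (sigma : {rmorphism L -> L}) :
  (forall x y : L, x != 0 -> y != 0 -> v (x * y) = v x + v y) ->
  (forall x y q, vge v x q -> vge v y q -> vge v (x + y) q) ->
  (forall x, x != 0 -> vgt v (sigma x / x - 1) 0) ->
  (forall x a, vge v x a -> vgt v (x - sigma x) a)
  /\ (forall x a, vgt v x a -> vgt v (sigma x) a).
Proof.
move=> vM vgeD wild.
have diff x a : vge v x a -> vgt v (x - sigma x) a.
  have [->|x0] := eqVneq x 0; first by rewrite rmorph0 subr0 vgt0.
  move=> xa; have -> : x - sigma x = - (x * (sigma x / x - 1)).
    by rewrite mulrBr mulrCA divff // !mulr1 opprB.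
  by apply: vgtN => //; rewrite -(addr0 a); apply: vgtM => //; apply: wild.
split=> // x a xa; rewrite -(subKr x (sigma x)); apply: vgtB => //.
exact/diff/vgt_ge.
Qed.

Theorem theorem4p6
  (l : nat) (hl : prime l) (hl2 : (2 < l)%N)
  (L : fieldType) (v : L -> rat) (K : {pred L})
  (hLK : Qlbar_data v l K)
  (F1 F2 : pser 4 L)
  (hZl : forall m, [/\ F1 m \in K, vge v (F1 m) 0, F2 m \in K & vge v (F2 m) 0])
  (hF : is_fgl2 F1 F2) (hsym : fgl_symmetric F1 F2)
  (hheight : fgl_height v l F1 F2 4) (hexp : fgl_exponent v l F1 F2 2)
  (sigma : {rmorphism L -> L}) (hsigma : in_wild_inertia v K sigma)
  (z1 z2 : L) (hz1 : vgt v z1 0) (hz2 : vgt v z2 0)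
  (htors1 : pser_eval_to v (fgl_mult F1 F2 l).1 [tuple z1; z2] 0)
  (htors2 : pser_eval_to v (fgl_mult F1 F2 l).2 [tuple z1; z2] 0) :
  sigma z1 = z1 /\ sigma z2 = z2.
Proof.
have [[vM vgeD [l_neq0 vl1]] [K1 KB KM _] [Kint _ _] _ _] := hLK.
have [[_ sigmaK] /(vgt_wild vM vgeD)[wild_diff wild_vgt]] := hsigma.
have vl : vge v l%:R 1 by rewrite /vge vl1 lexx orbT.
set f := (fgl_mult F1 F2 l).1 in htors1 *; set g := (fgl_mult F1 F2 l).2 in htors2 *.
pose o0 := @Ordinal 2 0 isT; pose o1 := @Ordinal 2 1 isT.
have [fZ gZ] : (forall m, f m \in K /\ vge v (f m) 0) /\
               (forall m, g m \in K /\ vge v (g m) 0).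
  have K0 : 0 \in K by rewrite -(subrr 1) KB.
  apply: (@fgl_mult_closed _ (fun x => x \in K /\ vge v x 0)).
  - by split; rewrite ?vge0.
  - by split; rewrite ?vge_one.
  - move=> x y [xK x0] [yK y0]; split; last exact: vgeD.
    by rewrite -[y]opprK; apply: (KB) => //; rewrite -sub0r; apply: KB.
  - by move=> x y [xK x0] [yK y0]; split; [apply: KM | rewrite -(addr0 0); apply: vgeM].
  - by move=> m; case: (hZl m).
  - by move=> m; case: (hZl m).
have l_gt0 := prime_gt0 hl.
have f0 : f 0%MM = 0 by apply: (fgl_mult_coeff0 hF l o0).
have g0 : g 0%MM = 0 by apply: (fgl_mult_coeff0 hF l o1).
have fU j : f U_(j)%MM = (o0 == j)%:R *+ l := fgl_mult_coeff1 hF o0 j l_gt0.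
have gU j : g U_(j)%MM = (o1 == j)%:R *+ l := fgl_mult_coeff1 hF o1 j l_gt0.
have [fb [gb [ffb ggb qdim]]] := hheight.
have [fb' [gb' [ffb' ggb' [fq gq] _]]] := hexp.
have Ef m : fb' m = fb m by apply: (reduces_to_inj vM vgeD hl vl (ffb' m) (ffb m)).
have Eg m : gb' m = gb m by apply: (reduces_to_inj vM vgeD hl vl (ggb' m) (ggb m)).
have frob (s : pser 2 L) (sb : pser 2 'F_l) :
    (forall m, s m \in K /\ vge v (s m) 0) -> s 0%MM = 0 ->
    (forall m, reduces_to v (s m) (sb m)) -> in_pow_sub l 2 sb ->
    frobenius_mod v l 2 s.
  move=> sZ s0 ssb sq; split=> // [m|m ndvd]; first by case: (sZ m).
  have sb0 : sb m = 0 by apply: contraNeq ndvd => /sq[-> ->].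
  have := ssb m; rewrite sb0 /reduces_to subr0 /vgt /vge.
  have [//|s_neq0 /=] := eqVneq (s m) 0.
  (* On [K] the valuation is integer-valued, so a positive valuation is at least 1. *)
  have [z ->] := Kint _ (sZ m).1 s_neq0.
  by rewrite -[1]/(1%:~R) ltr0z ler_int.
have fF := frob f fb' fZ f0 ffb' fq; have gF := frob g gb' gZ g0 ggb' gq.
have det : ~~ vgt v (f (mnm2 (l ^ 2) 0) * g (mnm2 0 (l ^ 2))
                     - f (mnm2 0 (l ^ 2)) * g (mnm2 (l ^ 2) 0)) 0.
  have eq0 a (c : 'F_l) : a = 0 -> reduces_to v a c -> c = 0.
    by move=> ->; apply: (reduces_to_eq0 vM vgeD hl vl); rewrite vgt0.
  have := @quot_dim_leading_matrix 'F_l (l ^ 2) fb gb.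
  (* Height 4 gives the dimension l^4 = (l^2)^2, which is q^2 for the q = l^2 of exponent 2. *)
  rewrite expn_gt0 l_gt0 -expnM => /(_ isT (eq0 _ _ f0 (ffb _)) (eq0 _ _ g0 (ggb _))).
  move=> /(_ _ _ qdim) lead; apply: contra (lead _ _) => [vdet|m|m].
  - apply/eqP; apply: (reduces_to_det vM vgeD hl vl _ _ (ffb _) (ffb _) (ggb _) (ggb _) vdet).
      by case: (fZ (mnm2 (l ^ 2) 0)).
    by case: (fZ (mnm2 0 (l ^ 2))).
  - by rewrite -Ef; apply: fq.
  - by rewrite -Eg; apply: gq.
have [z_eq0|z_neq0] := boolP ((z1 == 0) && (z2 == 0)).
  by case/andP: z_eq0 => /eqP-> /eqP->; rewrite rmorph0.
rewrite negb_and in z_neq0; have [c [z1c z2c min]] := vgt_pair_min v z_neq0.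
set z := [tuple z1; z2] in htors1 htors2.
pose w := [tuple sigma z1; sigma z2].
have c_gt0 : 0 < c.
  by rewrite ltNge; apply: contra min => lec0; rewrite !(vgtW lec0).
have zc i : vge v (tnth z i) c by case: (ord2P i) => ->.
have wE i : tnth w i = sigma (tnth z i) by case: (ord2P i) => ->.
(* The coefficients lie in [K], which [sigma] fixes, so [sigma] commutes with the partial sums, and
   [wild_vgt] carries over their bounds. *)
have tors_w (s : pser 2 L) : (forall m, s m \in K /\ vge v (s m) 0) ->
    pser_eval_to v s z 0 -> pser_eval_to v s w 0.
  move=> sZ tz r; have [N hN] := tz r; exists N => n leNn.
  have := hN n leNn; rewrite !subr0 => /wild_vgt.
  suff -> : (ptrunc s n).@[tnth w] = sigma (ptrunc s n).@[tnth z] by [].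
  rewrite !meval_ptrunc rmorph_sum; apply: eq_bigr => m _.
  rewrite rmorphM rmorph_prod sigmaK ?(sZ m).1 //.
  by congr (_ * _); apply: eq_bigr => i _; rewrite rmorphXn wE.
have slope := torsion_slope vM vgeD hl fF gF det htors1 htors2 c_gt0 zc min.
have : z = w.
  apply: (torsion_separated vM vgeD hl vl fF gF vl1 l_neq0 _ _ _ _
    htors1 htors2 (tors_w f fZ htors1) (tors_w g gZ htors2) c_gt0 slope zc) => [||||i].
  - by rewrite ?fU ?gU ?mul0rn.
  - by rewrite ?fU ?gU ?mul0rn.
  - by rewrite ?fU ?gU ?mul0rn.
  - by rewrite ?fU ?gU ?mul0rn.
  - by rewrite wE; apply: wild_diff.
by move=> /(congr1 val) [<- <-].
Qed.
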